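(* Consider the MSA coefficients $K_{ij}$ and $\gamma_j$ defined in the context, in the regime $\xi_c\to 0$, where the dimensionless concentrations $\nu_j>0$ and the ratios $\sigma_j/\sigma_c$, $\sigma_c/\sigma_j$, $D_i^0/D_c^0$, $D_c^0/D_i^0$ remain bounded. Assume that the dimensionless numbers $$bi=\frac{L_B}{\sigma_c},\qquad S=\frac{k_BT}{\eta D_c^0\sigma_c}$$ are of order one; it is enough that $bi$ and $S$ remain bounded as $\xi_c\to0$ (they may tend to zero too). Then the ideal case ($K_{ij}=\delta_{ij}$, $\gamma_j=1$) is the limit of the non-ideal MSA model for small characteristic solute packing fraction $\xi_c$, namely $$K_{ij}=\delta_{ij}+O(\sqrt{\xi_c}),\qquad \ln\gamma_j=O(\sqrt{\xi_c}),\qquad 1\le i,j\le N,$$ as $\xi_c\to0$.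
   Context: Fixed data: $N\ge 2$ ionic species with nonzero integer valencies $z_1<z_2<\dots<z_N$, $z_1<0<z_N$. Positive physical parameters: elementary charge $e$, dielectric constant $\mathcal E$, Boltzmann constant times temperature $k_BT$, viscosity $\eta$, ion diameters $\sigma_j$ with characteristic value $\sigma_c$, infinite-dilution diffusivities $D_i^0$ with characteristic value $D_c^0$, characteristic concentration $n_c$. The Bjerrum length is $L_B=e^2/(4\pi\mathcal E k_BT)$, and $\xi_c=\frac{\pi}{6}n_c\sigma_c^3$. Dimensionless concentrations are $\nu_j$, physical concentrations $n_j=n_c\nu_j$. Given the $n_j$, the screening parameter $\Gamma>0$ is defined by $\Gamma^2=\pi L_B\sum_{k=1}^N \frac{n_kz_k^2}{(1+\Gamma\sigma_k)^2}$, the packing fraction is $\xi=\frac{\pi}{6}\sum_k n_k\sigma_k^3=\xi_c\sum_k\nu_k(\sigma_k/\sigma_c)^3$, and with $p(\xi)=\xi\frac{8-9\xi+3\xi^2}{(1-\xi)^3}$ the activity coefficients are $$\gamma_j=\exp\Big\{p(\xi)-\frac{L_B\Gamma z_j^2}{1+\Gamma\sigma_j}\Big\}.$$ The coefficients $K_{ij}$ are $$K_{ij}=\Big(\delta_{ij}+\frac{k_BT}{D_i^0}\Omega_{ij}\Big)(1+\mathcal R_{ij}),\qquad \Omega_{ij}=\Omega^c_{ij}+\Omega^{HS}_{ij},$$ $$\Omega^c_{ij}=-\frac{1}{3\eta}\frac{z_iz_jL_Bn_j}{(1+\Gamma\sigma_i)(1+\Gamma\sigma_j)\Big(\Gamma+\sum_{k}n_k\frac{\pi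 L_Bz_k^2\sigma_k}{(1+\Gamma\sigma_k)^2}\Big)},\qquad \Omega^{HS}_{ij}=-\frac{(\sigma_i+\sigma_j)^2}{12\eta}n_j\frac{1-\tilde X_3/5+\tilde X_3^2/10}{1+2\tilde X_3},$$ $$\tilde X_3=\frac{\pi}{6}\sum_i n_i\frac{3X_1X_2+X_3X_0}{4X_0^2},\qquad X_k=\frac{\pi}{6}\sum_i n_i\sigma_i^k,$$ $$\mathcal R_{ij}=\frac{\kappa_q^2e^2z_iz_j}{3\mathcal Ek_BT(\sigma_i+\sigma_j)(1+\Gamma\sigma_i)(1+\Gamma\sigma_j)}\;\frac{1-e^{-2\kappa_q(\sigma_i+\sigma_j)}}{\kappa_q^2+2\Gamma\kappa_q+2\Gamma^2-2\pi L_B\sum_k n_k\frac{z_k^2e^{-\kappa_q\sigma_k}}{(1+\Gamma\sigma_k)^2}},$$ $$\kappa_q>0,\qquad \kappa_q^2=\frac{e^2}{\mathcal Ek_BT}\frac{\sum_i n_iz_i^2D_i^0}{\sum_iD_i^0}.$$ The constants implicit in $O(\cdot)$ depend only on $N$, the $z_j$ and the bounds on $bi=L_B/\sigma_c$, $S=k_BT/(\eta D_c^0\sigma_c)$, $\nu_j$ and the ratios $\sigma_j/\sigma_c$, $\sigma_c/\sigma_j$, $D_i^0/D_c^0$, $D_c^0/D_i^0$. *)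

(* Defs.v *)
From mathcomp Require Import all_boot all_order all_algebra.
From mathcomp Require Import all_classical all_reals all_analysis.
Set Implicit Arguments.
Unset Strict Implicit.
Unset Printing Implicit Defensive.
Import Order.TTheory GRing.Theory Num.Theory.
Import numFieldNormedType.Exports.
Local Open Scope classical_set_scope.
Local Open Scope ring_scope.

(* Species are numbered 0, ..., N-1: species 0 carries z_1, species N-1
   carries z_N. *)
Definition valencies (N : nat) (z : 'I_N -> int) : Prop :=
  [/\ forall i, z i != 0,
      forall i j : 'I_N, (i < j)%N -> z i < z j,
      forall i : 'I_N, i = 0%N :> nat -> z i < 0
    & forall i : 'I_N, i = N.-1 :> nat -> 0 < z i].

Record msa (R : realType) (N : nat) := Msa {
  echarge : R;        (* elementary charge e *)
  diel : R;           (* dielectric constant E *)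
  kT : R;             (* Boltzmann constant times temperature *)
  visc : R;           (* viscosity eta *)
  diam : 'I_N -> R;   (* ion diameters sigma_j *)
  diam_c : R;         (* characteristic diameter sigma_c *)
  diffus : 'I_N -> R;   (* infinite-dilution diffusivities D_i^0 *)
  diffus_c : R;         (* characteristic diffusivity D_c^0 *)
  conc_c : R;         (* characteristic concentration n_c *)
  nu : 'I_N -> R      (* dimensionless concentrations nu_j *)
}.

Definition positive_data (R : realType) (N : nat) (P : msa R N) : Prop :=
  [/\ [/\ 0 < echarge P, 0 < diel P, 0 < kT P & 0 < visc P],
      [/\ 0 < diam_c P, 0 < diffus_c P & 0 < conc_c P]
    & forall j, [/\ 0 < diam P j, 0 < diffus P j & 0 < nu P j]].

Definition conc (R : realType) (N : nat) (P : msa R N) (j : 'I_N) : R :=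
  conc_c P * nu P j.

Definition bjerrum (R : realType) (N : nat) (P : msa R N) : R :=
  echarge P ^+ 2 / (4 * pi * diel P * kT P).

Definition xi_c (R : realType) (N : nat) (P : msa R N) : R :=
  pi / 6 * conc_c P * diam_c P ^+ 3.

Definition bi (R : realType) (N : nat) (P : msa R N) : R :=
  bjerrum P / diam_c P.

Definition S_num (R : realType) (N : nat) (P : msa R N) : R :=
  kT P / (visc P * diffus_c P * diam_c P).

(* One bound serves for all the bounded quantities. The nu_j are bounded
   above only: they may tend to zero. *)
Definition bounded_data (R : realType) (N : nat) (M : R) (P : msa R N) : Prop :=
  [/\ bi P <= M, S_num P <= M
    & forall j, [/\ nu P j <= M,
        diam P j / diam_c P <= M, diam_c P / diam P j <= M,
        diffus P j / diffus_c P <= M & diffus_c P / diffus P j <= M]].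

Definition is_screening (R : realType) (N : nat) (z : 'I_N -> int)
    (P : msa R N) (Gam : R) : Prop :=
  0 < Gam /\
  Gam ^+ 2 = pi * bjerrum P *
    \sum_k conc P k * (z k)%:~R ^+ 2 / (1 + Gam * diam P k) ^+ 2.

Definition packing (R : realType) (N : nat) (P : msa R N) : R :=
  pi / 6 * \sum_k conc P k * diam P k ^+ 3.

Definition p_hs (R : realType) (x : R) : R :=
  x * ((8 - 9 * x + 3 * x ^+ 2) / (1 - x) ^+ 3).

Definition activity (R : realType) (N : nat) (z : 'I_N -> int)
    (P : msa R N) (Gam : R) (j : 'I_N) : R :=
  expR (p_hs (packing P)
        - bjerrum P * Gam * (z j)%:~R ^+ 2 / (1 + Gam * diam P j)).

Definition omega_c (R : realType) (N : nat) (z : 'I_N -> int)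
    (P : msa R N) (Gam : R) (i j : 'I_N) : R :=
  - (1 / (3 * visc P)) *
  ((z i)%:~R * (z j)%:~R * bjerrum P * conc P j /
   ((1 + Gam * diam P i) * (1 + Gam * diam P j) *
    (Gam + \sum_k conc P k *
       (pi * bjerrum P * (z k)%:~R ^+ 2 * diam P k /
        (1 + Gam * diam P k) ^+ 2)))).

Definition Xk (R : realType) (N : nat) (P : msa R N) (k : nat) : R :=
  pi / 6 * \sum_i conc P i * diam P i ^+ k.

Definition X3_tilde (R : realType) (N : nat) (P : msa R N) : R :=
  pi / 6 * \sum_i conc P i *
    ((3 * Xk P 1 * Xk P 2 + Xk P 3 * Xk P 0) / (4 * Xk P 0 ^+ 2)).

Definition omega_hs (R : realType) (N : nat) (P : msa R N) (i j : 'I_N) : R :=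
  - ((diam P i + diam P j) ^+ 2 / (12 * visc P)) * conc P j *
  ((1 - X3_tilde P / 5 + X3_tilde P ^+ 2 / 10) / (1 + 2 * X3_tilde P)).

Definition omega (R : realType) (N : nat) (z : 'I_N -> int)
    (P : msa R N) (Gam : R) (i j : 'I_N) : R :=
  omega_c z P Gam i j + omega_hs P i j.

Definition kappa_q (R : realType) (N : nat) (z : 'I_N -> int)
    (P : msa R N) : R :=
  Num.sqrt (echarge P ^+ 2 / (diel P * kT P) *
    ((\sum_i conc P i * (z i)%:~R ^+ 2 * diffus P i) / \sum_i diffus P i)).

Definition relax (R : realType) (N : nat) (z : 'I_N -> int)
    (P : msa R N) (Gam : R) (i j : 'I_N) : R :=
  let kq := kappa_q z P in
  kq ^+ 2 * echarge P ^+ 2 * (z i)%:~R * (z j)%:~R /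
  (3 * diel P * kT P * (diam P i + diam P j) *
   (1 + Gam * diam P i) * (1 + Gam * diam P j)) *
  ((1 - expR (- 2 * kq * (diam P i + diam P j))) /
   (kq ^+ 2 + 2 * Gam * kq + 2 * Gam ^+ 2 -
    2 * pi * bjerrum P *
    \sum_k conc P k *
      ((z k)%:~R ^+ 2 * expR (- kq * diam P k) / (1 + Gam * diam P k) ^+ 2))).

Definition Kcoef (R : realType) (N : nat) (z : 'I_N -> int)
    (P : msa R N) (Gam : R) (i j : 'I_N) : R :=
  ((i == j)%:R + kT P / diffus P i * omega z P Gam i j) *
  (1 + relax z P Gam i j).

(* The equation for Gamma has exactly one positive solution, so
   quantifying over the [Gam] with [is_screening z P Gam] is the same as
   taking Gamma to be a function of the data. *)
Lemma screening_exists_unique (R : realType) (N : nat) (z : 'I_N -> int)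
    (P : msa R N) :
  (0 < N)%N -> valencies z -> positive_data P ->
  exists! Gam, is_screening z P Gam.
Proof.
move=> N0 [z0 _ _ _] [[e0 E0 T0 v0] [sc0 Dc0 nc0] pos].
have sig0 k : 0 < diam P k by case: (pos k).
have L0 : 0 < pi * bjerrum P.
  rewrite /bjerrum mulr_gt0 ?pi_gt0 // divr_gt0 ?exprn_gt0 //.
  by rewrite !mulr_gt0 ?pi_gt0.
pose w k : R := conc P k * (z k)%:~R ^+ 2.
have w0 k : 0 < w k.
  apply: mulr_gt0; first by apply: mulr_gt0 => //; case: (pos k).
  by rewrite exprn_even_gt0 //= intr_eq0.
pose g (x : R) := \sum_k w k / (1 + x * diam P k) ^+ 2.
have den x k : 0 <= x -> 0 < 1 + x * diam P k.
  by move=> x0; rewrite ltr_wpDr // mulr_ge0 // ltW.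
have g_anti x y : 0 <= x -> x <= y -> g y <= g x.
  move=> x0 xy; apply: ler_sum => k _; have y0 := le_trans x0 xy.
  apply: ler_wpM2l; first exact: ltW.
  rewrite lef_pV2 ?posrE ?exprn_gt0 ?den //.
  have h : 1 + x * diam P k <= 1 + y * diam P k.
    by rewrite lerD2l ler_wpM2r // ltW.
  by apply: lerXn2r; rewrite ?nnegrE // ltW // den.
have g0 x : 0 <= x -> 0 < g x.
  move=> x0; rewrite /g (bigD1 (Ordinal N0)) //= ltr_wpDr //.
    by apply: sumr_ge0 => k _; rewrite divr_ge0 ?ltW // exprn_gt0 // den.
  by rewrite divr_gt0 // exprn_gt0 // den.
pose f x := x ^+ 2 - pi * bjerrum P * g x.
pose b : R := 1 + pi * bjerrum P * g 0.
have b1 : 1 <= b by rewrite lerDl mulr_ge0 ?ltW ?g0.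
have b0 : 0 <= b by exact: le_trans b1.
have fcont : {within `[0, b], continuous f}.
  apply: continuous_in_subspaceT => x; rewrite inE /= in_itv /= => /andP[x0 _].
  have lin_cvg k : y * diam P k @[y --> x] --> x * diam P k.
    by apply: cvgM; [exact: cvg_id | exact: cvg_cst].
  have aff_cvg k : 1 + y * diam P k @[y --> x] --> 1 + x * diam P k.
    by apply: cvgD; [exact: cvg_cst | exact: lin_cvg].
  have g_cvg : g y @[y --> x] --> g x.
    rewrite /g; elim: (index_enum _) => [|k s IHs].
      rewrite big_nil; under eq_fun do rewrite big_nil.
      exact: cvg_cst.
    rewrite big_cons; under eq_fun do rewrite big_cons.
    apply: cvgD IHs; apply: cvgM; first exact: cvg_cst.
    apply: cvgV; first by rewrite gt_eqF // exprn_gt0 // den.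
    by apply: cvgM; exact: aff_cvg.
  apply: cvgB; first by apply: cvgM; exact: cvg_id.
  by apply: cvgM g_cvg; exact: cvg_cst.
have f00 : f 0 <= 0.
  by rewrite /f expr0n /= sub0r oppr_le0 mulr_ge0 // ltW // g0.
have fb : 0 <= f b.
  have gb := g_anti 0 b (lexx _) b0.
  have : pi * bjerrum P * g b <= pi * bjerrum P * g 0 by rewrite ler_wpM2l // ltW.
  rewrite /f => h; rewrite subr_ge0 (le_trans h) // (@le_trans _ _ b) //.
    by rewrite /b lerDr.
  by rewrite expr2 ler_peMr.
have [|c] := @IVT R f 0 b 0 b0 fcont.
  by rewrite ge_min le_max f00 fb orbT.
rewrite in_itv /= => /andP[c0 _] /eqP; rewrite /f subr_eq0 => /eqP fc.
have cpos : 0 < c.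
  have c2 : 0 < c ^+ 2 by rewrite fc mulr_gt0 // g0.
  rewrite lt0r c0 andbT; apply: contraTneq c2 => ->.
  by rewrite expr0n /= ltxx.
exists c; split; first by split.
have lt_contra x y : 0 < x -> x < y -> x ^+ 2 = pi * bjerrum P * g x ->
    y ^+ 2 = pi * bjerrum P * g y -> False.
  move=> x0 xy ex ey; have y0 := lt_trans x0 xy.
  have := g_anti x y (ltW x0) (ltW xy).
  rewrite -(ler_pM2l L0) -ex -ey leNgt => /negP; apply.
  by rewrite ltrXn2r // ltW.
move=> d [d0 ed]; case: (ltgtP c d) => // h.
  by case: (lt_contra c d).
by case: (lt_contra d c).
Qed.

(* Main.v *)
Require Import Defs.
From mathcomp Require Import all_boot all_order all_algebra.
From mathcomp Require Import all_classical all_reals all_analysis.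
From mathcomp Require Import ring lra.
Import Order.TTheory GRing.Theory Num.Theory.
Local Open Scope ring_scope.

(** Measured in units of the characteristic diameter [s], each inverse length
    of the model is small. The screening equation gives [(Gam * s)^2 = O(xi)],
    because the denominators [(1 + Gam * sigma_k)^2] only decrease its right
    side ([screening_le]). Likewise [(kappa_q * s)^2 = O(xi)], since the weights
    [D_i / sum D] are at most 1 ([kappa_q_le]). Both squares have the form
    [L * s^2 * (sum n_k z_k^2)], that is [bi] times [n_c * s^3], which is of
    order [xi]. This is where the square root of [xi] comes from.

    In [ln gamma_j] the hard-sphere term is [O(xi)] and the Coulomb term is at
    most [bi * (Gam * s) * z_j^2]. In [K_ij] three corrections appear.
    - The Coulomb friction carries a factor [L * n_j / Gam], which is 0/0 in the
      limit. The screening equation contains the [j]th term on its right side,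
      so that [L * n_j <= Gam^2 * (1 + Gam * sigma_j)^2]: the quotient is
      [O(Gam)], without any lower bound on the concentrations
      ([screening_dominates], [omega_c_le]).
    - The hard-sphere friction is proportional to [n_j * s^3 = O(xi)]
      ([omega_hs_le]).
    - In the relaxation term the quotient [kappa_q^2 / Den] is again 0/0.
      Substituting the screening equation for [2 * Gam^2] in [Den] shows that
      [Den >= kappa_q^2] ([relax_denominator_ge]), so that this quotient is at
      most 1. The factor [1 - exp (- 2 kappa_q (sigma_i + sigma_j))] is
      [O(kappa_q)], and cancels the denominator [sigma_i + sigma_j]
      ([relax_le]).

    All constants are explicit in [M], [N] and [sum z_k^2]; [xi] is taken so
    small that the packing fraction is at most 1/2, which keeps the pole of [p]
    at distance 1/2. *)

(** * Elementary inequalities *)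

Lemma ler_pdiv_ge1 (R : realFieldType) (x y : R) :
  0 <= x -> 1 <= y -> x / y <= x.
Proof.
move=> x0 y1; rewrite ler_pdivrMr; first exact: ler_peMr.
exact: lt_le_trans y1.
Qed.

Lemma norm_mul_le (R : realDomainType) (x y a b : R) :
  `|x| <= a -> `|y| <= b -> `|x * y| <= a * b.
Proof. by move=> xa yb; rewrite normrM ler_pM. Qed.

Lemma one_minus_expRN_le (R : realType) (x : R) :
  0 <= x -> 0 <= 1 - expR (- x) <= x.
Proof.
move=> x0; have := expR_ge1Dx (- x).
have : expR (- x) <= 1 by rewrite -expR0 ler_expR oppr_le0.
lra.
Qed.

(** On [0, 1/2] the numerator of [p_hs x / x] is at most 8 and the denominator
    [(1 - x)^3] at least 1/8. *)
Lemma p_hs_le (R : realType) (x : R) : 0 <= x <= 1 / 2 -> `|p_hs x| <= 64 * x.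
Proof.
move=> /andP[x0 x2]; have h1 : 1 / 8 <= (1 - x) ^+ 3.
  have -> : 1 / 8 = (1 / 2) ^+ 3 :> R by field.
  by apply: lerXn2r; rewrite ?nnegrE; lra.
have h0 : 0 < (1 - x) ^+ 3 by apply: lt_le_trans h1; lra.
have n0 : 0 <= 8 - 9 * x + 3 * x ^+ 2 by nra.
have n8 : 8 - 9 * x + 3 * x ^+ 2 <= 8 by nra.
rewrite /p_hs ger0_norm; last by rewrite mulr_ge0 // divr_ge0 // ltW.
by rewrite mulrC ler_wpM2r // ler_pdivrMr //; lra.
Qed.

Lemma hs_friction_factor_le (R : realFieldType) (x : R) : 0 <= x <= 1 / 2 ->
  `|(1 - x / 5 + x ^+ 2 / 10) / (1 + 2 * x)| <= 1.
Proof.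
move=> /andP[x0 x2].
have n0 : 0 <= 1 - x / 5 + x ^+ 2 / 10 by nra.
have d0 : 0 < 1 + 2 * x by lra.
rewrite ger0_norm; last by rewrite divr_ge0 // ltW.
by rewrite ler_pdivrMr //; nra.
Qed.

(** First-order errors stay first-order: the product [w * r] of the two
    corrections is [O(q^2)], hence [O(q)] for [q <= 1]. *)
Lemma perturbed_product_le (R : realDomainType) (d w r a b q : R) :
  `|d| <= 1 -> `|w| <= a * q -> `|r| <= b * q -> 0 <= q <= 1 ->
  `|(d + w) * (1 + r) - d| <= (a + b + a * b) * q.
Proof.
move=> d1 wa rb /andP[q0 q1].
have -> : (d + w) * (1 + r) - d = w + d * r + w * r by ring.
have dr : `|d * r| <= b * q by rewrite -[leRHS]mul1r norm_mul_le.
have wr : `|w * r| <= a * b * q.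
  apply: le_trans (norm_mul_le _ _ _ _ _ wa rb) _.
  have aq0 := le_trans (normr_ge0 _) wa; have bq0 := le_trans (normr_ge0 _) rb.
  (* The signs of [a] and [b] follow from the hypotheses only for [q != 0]. *)
  have [->|qn0] := eqVneq q 0; first by rewrite !mulr0.
  have qp : 0 < q by rewrite lt0r qn0.
  have a0 : 0 <= a by rewrite -(pmulr_lge0 _ qp).
  rewrite mulrACA ler_wpM2l //; first by rewrite mulr_ge0 // -(pmulr_lge0 _ qp).
  by rewrite ler_piMl.
rewrite !mulrDl; apply: le_trans (ler_normD _ _) _; apply: lerD => //.
by apply: le_trans (ler_normD _ _) _; apply: lerD.
Qed.

(** * Scales: diameters, concentrations, screening lengths *)

Section Estimates.

Variables (R : realType) (N : nat) (z : 'I_N -> int) (P : msa R N) (Gam M : R).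
Hypotheses (hN : (2 <= N)%N) (z_neq0 : forall i, z i != 0).
Hypotheses (pos : positive_data P) (bnd : bounded_data M P).
Hypothesis scr : is_screening z P Gam.
Hypothesis xi_small : N%:R * M ^+ 4 * xi_c P <= 1 / 2.

Local Notation s := (diam_c P).
Local Notation L := (bjerrum P).
Local Notation xi := (xi_c P).
Local Notation q := (Num.sqrt (xi_c P)).
Local Notation Z := (\sum_k (z k)%:~R ^+ 2 : R).
Local Notation zr k := ((z k)%:~R : R).

Let s_gt0 : 0 < s. Proof. by case: pos => _ []. Qed.
Let nc_gt0 : 0 < conc_c P. Proof. by case: pos => _ []. Qed.
Let Dc_gt0 : 0 < diffus_c P. Proof. by case: pos => _ []. Qed.
Let diam_gt0 j : 0 < diam P j. Proof. by case: pos => _ _ /(_ j)[]. Qed.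
Let diffus_gt0 j : 0 < diffus P j. Proof. by case: pos => _ _ /(_ j)[]. Qed.
Let nu_gt0 j : 0 < nu P j. Proof. by case: pos => _ _ /(_ j)[]. Qed.
Let e_gt0 : 0 < echarge P. Proof. by case: pos => -[]. Qed.
Let diel_gt0 : 0 < diel P. Proof. by case: pos => -[]. Qed.
Let kT_gt0 : 0 < kT P. Proof. by case: pos => -[]. Qed.
Let visc_gt0 : 0 < visc P. Proof. by case: pos => -[]. Qed.
Let Gam_gt0 : 0 < Gam. Proof. by case: scr. Qed.
Let conc_gt0 j : 0 < conc P j. Proof. by rewrite mulr_gt0. Qed.
Let pi2 : 2 <= pi :> R. Proof. exact: pi_ge2. Qed.
Let pi4 : pi <= 4 :> R. Proof. have := pihalf_lt2 R; lra. Qed.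
Let L_gt0 : 0 < L.
Proof. by rewrite divr_gt0 ?exprn_gt0 // !mulr_gt0 ?pi_gt0. Qed.

Let i0 : 'I_N := Ordinal (ltnW hN).

Let diam_le j : diam P j <= M * s.
Proof. by case: bnd => _ _ /(_ j)[_ h _ _ _]; rewrite -ler_pdivrMr. Qed.

Let diffus_ge j : diffus_c P <= M * diffus P j.
Proof. by case: bnd => _ _ /(_ j)[_ _ _ _ h]; rewrite -ler_pdivrMr. Qed.

Let nu_le j : nu P j <= M. Proof. by case: bnd => _ _ /(_ j)[]. Qed.

Let M_gt0 : 0 < M. Proof. exact: lt_le_trans (nu_gt0 i0) (nu_le i0). Qed.

(** [sigma_j / s] and its inverse are both at most [M], and their product
    is 1. *)
Lemma bound_ge1 : 1 <= M.
Proof.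
case: bnd => _ _ /(_ i0)[_ h1 h2 _ _].
rewrite -(@ler_pXn2r _ 2) ?nnegrE ?ler01 ?(ltW M_gt0) // expr1n expr2.
have -> : 1 = diam P i0 / s * (s / diam P i0).
  by field; rewrite !gt_eqF.
by apply: ler_pM => //; rewrite divr_ge0 // ltW.
Qed.
Let M1 := bound_ge1.

Let den_ge1 j : 1 <= 1 + Gam * diam P j.
Proof. by rewrite lerDl mulr_ge0 // ltW. Qed.
Let den_gt0 j : 0 < 1 + Gam * diam P j.
Proof. exact: lt_le_trans (den_ge1 j). Qed.

Let bjerrum_le : L <= M * s.
Proof. by case: bnd => h _ _; rewrite -ler_pdivrMr. Qed.

(* The left side is [s] times [S] times [D_c / D_i]. *)
Let einstein_le i : kT P / (visc P * diffus P i) <= M ^+ 2 * s.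
Proof.
case: bnd => _ + _; rewrite /S_num ler_pdivrMr ?mulr_gt0 // => h.
rewrite ler_pdivrMr ?mulr_gt0 //; apply: le_trans h _.
have -> : M ^+ 2 * s * (visc P * diffus P i) =
  M * (visc P * (M * diffus P i) * s) by ring.
rewrite ler_pM2l // ler_pM2r // ler_pM2l //.
Qed.

Let xi_gt0 : 0 < xi.
Proof. by rewrite !mulr_gt0 ?pi_gt0 ?exprn_gt0 // invr_gt0. Qed.

Lemma packing_scale_le1 : xi <= 1.
Proof.
have N1 : 1 <= N%:R :> R by rewrite ler1n ltnW.
have M4 : 1 <= M ^+ 4 by rewrite exprn_ege1.
have NM : 1 <= N%:R * M ^+ 4 by rewrite mulr_ege1.
apply: le_trans (ler_peMl (ltW xi_gt0) NM) (le_trans xi_small _).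
by rewrite ler_pdivrMr // mul1r ler1n.
Qed.

Let q_ge0 : 0 <= q. Proof. exact: sqrtr_ge0. Qed.
Let q_sqr : q ^+ 2 = xi. Proof. by rewrite sqr_sqrtr // ltW. Qed.
Let q_le1 : q <= 1.
Proof. by rewrite -sqrtr1 ler_sqrt // packing_scale_le1. Qed.
Let xi_le_q : xi <= q.
Proof. by rewrite -{1}q_sqr expr2 ler_piMl. Qed.

Lemma valency_sqr_ge1 j : 1 <= zr j ^+ 2.
Proof. by rewrite -rmorphXn /= ler1z -gtz0_ge1 exprn_even_gt0 //= z_neq0. Qed.

Let valency_sqr_le j : zr j ^+ 2 <= Z.
Proof.
by rewrite (bigD1 j) //= lerDl sumr_ge0 // => k _; rewrite sqr_ge0.
Qed.

Let Z_ge1 : 1 <= Z.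
Proof. exact: le_trans (valency_sqr_ge1 i0) (valency_sqr_le i0). Qed.

Let valency_mul_le i j : `|zr i * zr j| <= Z.
Proof.
have hi := valency_sqr_le i; have hj := valency_sqr_le j.
rewrite ler_norml; apply/andP; split; nra.
Qed.

(* [n_c * s^3 = 6 * xi / pi], and [6 / pi <= 3]. *)
Let conc_le j : conc P j * s ^+ 3 <= 3 * M * xi.
Proof.
have ns : 0 < conc_c P * s ^+ 3 by rewrite mulr_gt0 ?exprn_gt0.
have h : conc_c P * s ^+ 3 <= 3 * xi.
  have -> : 3 * xi = pi / 2 * (conc_c P * s ^+ 3) by rewrite /xi_c; field.
  by rewrite ler_peMl ?(ltW ns) // ler_pdivlMr ?mul1r.
have -> : conc P j * s ^+ 3 = nu P j * (conc_c P * s ^+ 3).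
  by rewrite /conc; ring.
rewrite [3 * M]mulrC -mulrA; apply: ler_pM => //; exact: ltW.
Qed.

Let charge_ge0 k : 0 <= conc P k * zr k ^+ 2.
Proof. by rewrite mulr_ge0 ?sqr_ge0 // ltW. Qed.

(** Up to a factor [4 * pi] the left side is the square of an inverse Debye
    length in units of [s]; the squares of both screening parameters are bounded by
    multiples of it. *)
Lemma charge_density_le :
  L * s ^+ 2 * (\sum_k conc P k * zr k ^+ 2) <= 3 * M ^+ 2 * Z * xi.
Proof.
have h : s ^+ 3 * (\sum_k conc P k * zr k ^+ 2) <= 3 * M * xi * Z.
  rewrite !mulr_sumr; apply: ler_sum => k _.
  by rewrite mulrA [s ^+ 3 * _]mulrC ler_wpM2r // sqr_ge0.
have S0 : 0 <= \sum_k conc P k * zr k ^+ 2.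
  by apply: sumr_ge0 => k _; exact: charge_ge0.
apply: (@le_trans _ _ (M * (s ^+ 3 * \sum_k conc P k * zr k ^+ 2))).
  have -> : M * (s ^+ 3 * \sum_k conc P k * zr k ^+ 2) =
    M * s * (s ^+ 2 * \sum_k conc P k * zr k ^+ 2) by ring.
  by rewrite -[_ * _ * \sum_k _]mulrA ler_wpM2r // mulr_ge0 ?sqr_ge0.
have -> : 3 * M ^+ 2 * Z * xi = M * (3 * M * xi * Z) by ring.
by rewrite ler_pM2l.
Qed.

Let Z_ge0 : 0 <= Z. Proof. exact: le_trans Z_ge1. Qed.

Let scale_ge0 : 0 <= M ^+ 2 * Z * xi.
Proof. by rewrite mulr_ge0 ?(ltW xi_gt0) // mulr_ge0 ?sqr_ge0. Qed.

(* [Z <= Z^2] avoids a second square root, of [Z], in the constants. *)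
Let le_of_sqr_le (x a : R) : 0 <= x -> 0 <= a ->
  x ^+ 2 <= a ^+ 2 * (M ^+ 2 * Z * xi) -> x <= a * M * Z * q.
Proof.
move=> x0 a0 h; rewrite -ler_sqr ?nnegrE //; last first.
  by rewrite !mulr_ge0 ?(ltW M_gt0).
apply: le_trans h _.
have -> : (a * M * Z * q) ^+ 2 = a ^+ 2 * (M ^+ 2 * Z * xi) * Z.
  by rewrite exprMn q_sqr; ring.
by rewrite ler_peMr // mulr_ge0 ?sqr_ge0.
Qed.

(** The denominators of the screening equation are at least 1; dropping them
    leaves [Gam^2 <= pi * L * (sum n_k z_k^2)]. *)
Lemma screening_le : Gam * s <= 4 * M * Z * q.
Proof.
case: scr => _ G2; apply: le_of_sqr_le => //; first by rewrite mulr_ge0 // ltW.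
have h : \sum_k conc P k * zr k ^+ 2 / (1 + Gam * diam P k) ^+ 2
    <= \sum_k conc P k * zr k ^+ 2.
  apply: ler_sum => k _; apply: ler_pdiv_ge1; last by rewrite exprn_ege1.
  by rewrite mulr_ge0 ?sqr_ge0 // ltW.
have L2 : 0 <= L * s ^+ 2 by rewrite mulr_ge0 ?sqr_ge0 // ltW.
rewrite exprMn G2; move: h; set T' := \sum_k _ / _ => h.
have h3 := le_trans (ler_wpM2l L2 h) charge_density_le.
have -> : pi * L * T' * s ^+ 2 = pi * (L * s ^+ 2 * T') by ring.
apply: (@le_trans _ _ (4 * (3 * M ^+ 2 * Z * xi))); last first.
  by have := scale_ge0; lra.
apply: (@le_trans _ _ (pi * (3 * M ^+ 2 * Z * xi))).
  by rewrite ler_wpM2l // (le_trans _ pi2).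
by rewrite ler_wpM2r //; have := scale_ge0; lra.
Qed.

(** [e^2 / (E k_B T)] is [4 * pi] times the Bjerrum length. *)
Lemma kappa_q_sqr : kappa_q z P ^+ 2 = 4 * pi * L *
  ((\sum_i conc P i * zr i ^+ 2 * diffus P i) / \sum_i diffus P i).
Proof.
rewrite /kappa_q sqr_sqrtr.
  congr (_ * _); rewrite /bjerrum.
  by move: (pi_gt0 R); move: pi => p p_gt0; field; rewrite !gt_eqF.
apply: mulr_ge0; first by rewrite divr_ge0 ?sqr_ge0 // mulr_ge0 // ltW.
apply: divr_ge0; apply: sumr_ge0 => k _; last exact: ltW.
by rewrite mulr_ge0 ?charge_ge0 // ltW.
Qed.

Lemma kappa_q_le : kappa_q z P * s <= 7 * M * Z * q.
Proof.
apply: le_of_sqr_le => //; first by rewrite mulr_ge0 ?sqrtr_ge0 // ltW.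
have D0 : 0 < \sum_i diffus P i.
  rewrite (bigD1 i0) //= ltr_wpDr // sumr_ge0 // => k _; exact: ltW.
have h : (\sum_i conc P i * zr i ^+ 2 * diffus P i) / \sum_i diffus P i
    <= \sum_i conc P i * zr i ^+ 2.
  rewrite ler_pdivrMr // mulr_suml; apply: ler_sum => k _.
  rewrite ler_wpM2l //.
  by rewrite (bigD1 k) //= lerDl sumr_ge0 // => l _; exact: ltW.
rewrite exprMn kappa_q_sqr; move: h; set T' := _ / _ => h.
have L2 : 0 <= L * s ^+ 2 by rewrite mulr_ge0 ?sqr_ge0 // ltW.
have h3 := le_trans (ler_wpM2l L2 h) charge_density_le.
have -> : 4 * pi * L * T' * s ^+ 2 = 4 * pi * (L * s ^+ 2 * T') by ring.
apply: (@le_trans _ _ (16 * (3 * M ^+ 2 * Z * xi))); last first.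
  by have := scale_ge0; lra.
apply: (@le_trans _ _ (4 * pi * (3 * M ^+ 2 * Z * xi))).
  by rewrite ler_wpM2l // mulr_ge0 // (le_trans _ pi2).
by rewrite ler_wpM2r //; [have := scale_ge0 | have := pi4]; lra.
Qed.

(** * Hard-sphere moments *)

Let Xk0_gt0 : 0 < Xk P 0.
Proof.
rewrite mulr_gt0 ?divr_gt0 ?pi_gt0 // (bigD1 i0) //= ltr_wpDr ?expr0 ?mulr1 //.
by apply: sumr_ge0 => k _; rewrite expr0 mulr1 ltW.
Qed.

Let Xk_ge0 k : 0 <= Xk P k.
Proof.
rewrite mulr_ge0 ?divr_ge0 ?pi_ge0 // sumr_ge0 // => j _.
by rewrite mulr_ge0 ?exprn_ge0 // ltW.
Qed.

Lemma Xk_le k : Xk P k <= (M * s) ^+ k * Xk P 0.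
Proof.
rewrite /Xk mulrCA ler_wpM2l ?divr_ge0 ?pi_ge0 // mulr_sumr.
apply: ler_sum => j _.
rewrite expr0 mulr1 mulrC ler_wpM2r ?(ltW (conc_gt0 _)) //.
by apply: lerXn2r; rewrite ?nnegrE // ?mulr_ge0 // ltW.
Qed.

(** The left side is the packing fraction of spheres that all have the largest
    diameter allowed by [M]. It bounds [packing P], which is [Xk P 3], and
    [X3_tilde P]. *)
Lemma third_moment_le : (M * s) ^+ 3 * Xk P 0 <= N%:R * M ^+ 4 * xi.
Proof.
have -> : (M * s) ^+ 3 * Xk P 0 = M ^+ 3 * xi * \sum_i nu P i.
  rewrite /Xk /xi_c.
  under eq_bigr do rewrite expr0 mulr1.
  by rewrite /conc -mulr_sumr; ring.
have h : \sum_i nu P i <= N%:R * M.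
  apply: (@le_trans _ _ (\sum_(i < N) M)); first exact: ler_sum.
  by rewrite sumr_const card_ord mulr_natl.
have -> : N%:R * M ^+ 4 * xi = M ^+ 3 * xi * (N%:R * M) by ring.
by rewrite ler_wpM2l // mulr_ge0 ?exprn_ge0 // ltW.
Qed.

Lemma packing_le : packing P <= N%:R * M ^+ 4 * xi.
Proof. exact: le_trans (Xk_le 3) third_moment_le. Qed.

(** The summand of [X3_tilde] does not depend on the species except through
    [conc P i], so that the sum produces one factor [Xk P 0]. *)
Lemma X3_tildeE :
  X3_tilde P = (3 * Xk P 1 * Xk P 2 + Xk P 3 * Xk P 0) / (4 * Xk P 0).
Proof.
rewrite /X3_tilde -mulr_suml mulrA.
have -> : pi / 6 * (\sum_i conc P i) = Xk P 0.
  by rewrite /Xk; under [in RHS]eq_bigr do rewrite expr0 mulr1.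
by field; rewrite gt_eqF.
Qed.

(** Since [Xk P k <= (M * s)^k * Xk P 0], both terms of the numerator are at
    most a multiple of [(M * s)^3 * (Xk P 0)^2], and the four multiples of it
    cancel the 4 in the denominator. *)
Lemma X3_tilde_itv : 0 <= X3_tilde P <= 1 / 2.
Proof.
have h0 : 0 <= 3 * Xk P 1 * Xk P 2 + Xk P 3 * Xk P 0.
  by rewrite addr_ge0 // mulr_ge0 // mulr_ge0.
have X04 : 0 < 4 * Xk P 0 by rewrite mulr_gt0.
rewrite X3_tildeE; apply/andP; split; first by rewrite divr_ge0 // ltW.
apply: le_trans (le_trans third_moment_le xi_small).
rewrite ler_pdivrMr //.
have h12 : Xk P 1 * Xk P 2 <= (M * s) ^+ 3 * Xk P 0 ^+ 2.
  have -> : (M * s) ^+ 3 * Xk P 0 ^+ 2 =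
     (M * s) ^+ 1 * Xk P 0 * ((M * s) ^+ 2 * Xk P 0) by ring.
  by apply: ler_pM => //; exact: Xk_le.
have h30 : Xk P 3 * Xk P 0 <= (M * s) ^+ 3 * Xk P 0 ^+ 2.
  have -> : (M * s) ^+ 3 * Xk P 0 ^+ 2 = (M * s) ^+ 3 * Xk P 0 * Xk P 0 by ring.
  by rewrite ler_wpM2r //; exact: Xk_le.
have -> : (M * s) ^+ 3 * Xk P 0 * (4 * Xk P 0) =
   4 * ((M * s) ^+ 3 * Xk P 0 ^+ 2) by ring.
rewrite -mulrA; lra.
Qed.

(** * Activity coefficients *)

Lemma ln_activity_le j :
  `|ln (activity z P Gam j)| <=
    (64 * N%:R * M ^+ 4 + 4 * M ^+ 2 * Z ^+ 2) * q.
Proof.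
rewrite /activity expRK mulrDl.
apply: le_trans (ler_normB _ _) _; apply: lerD.
  have hp := packing_le.
  apply: le_trans (p_hs_le _ _ _) _.
    by rewrite (le_trans hp) // andbT; exact: (Xk_ge0 3).
  apply: (@le_trans _ _ (64 * N%:R * M ^+ 4 * xi)).
    by rewrite -(mulrA 64) -(mulrA 64) ler_pM2l.
  by rewrite ler_wpM2l // mulr_ge0 ?exprn_ge0 ?(ltW M_gt0) // mulr_ge0.
have t0 : 0 <= L * Gam * zr j ^+ 2
  by rewrite mulr_ge0 ?sqr_ge0 // mulr_ge0 // ltW.
rewrite ger0_norm; last by rewrite divr_ge0 // ltW.
apply: le_trans (ler_pdiv_ge1 _ _ _ t0 (den_ge1 j)) _.
have -> : 4 * M ^+ 2 * Z ^+ 2 * q = M * (4 * M * Z * q) * Z by ring.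
apply: ler_pM => //; [by rewrite mulr_ge0 // ltW | exact: sqr_ge0 |].
apply: (@le_trans _ _ (M * (Gam * s))).
  have -> : M * (Gam * s) = M * s * Gam by ring.
  by rewrite ler_pM2r.
by rewrite ler_pM2l // screening_le.
Qed.

(** * The coefficients K *)

(** The [j]th term alone of the screening equation is at most [Gam^2], and
    [pi * z_j^2 >= 1]. This controls [L * n_j / Gam] even if [Gam], [L] or [n_j]
    tends to zero at any relative rate. *)
Lemma screening_dominates j :
  L * conc P j <= Gam ^+ 2 * (1 + Gam * diam P j) ^+ 2.
Proof.
case: scr => _ G2; rewrite -ler_pdivrMr ?exprn_gt0 // G2.
rewrite (bigD1 j) //=; set T := \sum_(k | _) _.
have T0 : 0 <= T.
  apply: sumr_ge0 => k _.
  by rewrite divr_ge0 ?charge_ge0 ?sqr_ge0.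
apply: (@le_trans _ _
  (pi * L * (conc P j * zr j ^+ 2 / (1 + Gam * diam P j) ^+ 2))).
  have -> : pi * L * (conc P j * zr j ^+ 2 / (1 + Gam * diam P j) ^+ 2) =
     pi * zr j ^+ 2 * (L * conc P j / (1 + Gam * diam P j) ^+ 2).
    by field; rewrite gt_eqF.
  rewrite ler_peMl //; first by rewrite divr_ge0 ?sqr_ge0 // mulr_ge0 // ltW.
  by rewrite mulr_ege1 ?valency_sqr_ge1 //; have := pi2; lra.
by rewrite ler_pM2l ?lerDl // mulr_gt0 // pi_gt0.
Qed.

(** The denominator of [omega_c] is at least
    [(1 + Gam * sigma_j) * Gam], so that [screening_dominates] leaves a multiple
    of [Gam * s], to which [screening_le] applies. *)
Lemma omega_c_le i j :
  `|kT P / diffus P i * omega_c z P Gam i j| <=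
    4 * M ^+ 3 * Z ^+ 2 * (1 + 4 * M ^+ 2 * Z) * q.
Proof.
have ges := screening_le.
rewrite /omega_c; set T := \sum_k _.
have T0 : 0 <= T.
  apply: sumr_ge0 => k _; rewrite mulr_ge0 ?(ltW (conc_gt0 _)) //.
  apply: divr_ge0; last exact: sqr_ge0.
  apply: mulr_ge0; last exact: ltW.
  by rewrite mulr_ge0 ?sqr_ge0 // mulr_ge0 ?pi_ge0 // ltW.
set di := 1 + Gam * diam P i; set dj := 1 + Gam * diam P j.
have di1 : 1 <= di := den_ge1 i.
have dj0 : 0 < dj := den_gt0 j.
have GT : 0 < Gam + T by rewrite ltr_wpDr.
have -> : kT P / diffus P i * (- (1 / (3 * visc P)) *
    (zr i * zr j * L * conc P j / (di * dj * (Gam + T)))) =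
  - (1 / 3) * ((kT P / (visc P * diffus P i)) *
   (zr i * zr j * (L * conc P j / (di * dj * (Gam + T))))).
  by field; rewrite !gt_eqF // (lt_le_trans _ di1).
have dd : L * conc P j / (di * dj * (Gam + T)) <= Gam * dj.
  rewrite ler_pdivrMr; last by rewrite !mulr_gt0 // (lt_le_trans _ di1).
  apply: le_trans (screening_dominates j) _.
  have -> : Gam * dj * (di * dj * (Gam + T)) = Gam * dj ^+ 2 * (di * (Gam + T)).
    by ring.
  have -> : Gam ^+ 2 * (1 + Gam * diam P j) ^+ 2 = Gam * dj ^+ 2 * Gam.
    by rewrite -/dj; ring.
  rewrite ler_wpM2l //; first by rewrite mulr_ge0 ?sqr_ge0 // ltW.
  apply: (@le_trans _ _ (Gam + T)); first by rewrite lerDl.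
  by rewrite ler_peMl // ltW.
have dd0 : 0 <= L * conc P j / (di * dj * (Gam + T)).
  apply: divr_ge0; first by rewrite mulr_ge0 // ltW.
  by rewrite ltW // !mulr_gt0 // (lt_le_trans _ di1).
have kd0 : 0 <= kT P / (visc P * diffus P i).
  by rewrite divr_ge0 // ?mulr_ge0 // ltW.
rewrite normrM.
apply: (@le_trans _ _ `|kT P / (visc P * diffus P i) *
   (zr i * zr j * (L * conc P j / (di * dj * (Gam + T))))|).
  by rewrite ler_piMl // normrN ger0_norm; lra.
apply: (@le_trans _ _ (M ^+ 2 * s * (Z * (Gam * dj)))).
  apply: norm_mul_le; first by rewrite ger0_norm.
  by apply: norm_mul_le => //; rewrite ger0_norm.
have -> : M ^+ 2 * s * (Z * (Gam * dj)) = M ^+ 2 * Z * ((Gam * s) * dj) by ring.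
have -> : 4 * M ^+ 3 * Z ^+ 2 * (1 + 4 * M ^+ 2 * Z) * q =
   M ^+ 2 * Z * ((4 * M * Z * q) * (1 + 4 * M ^+ 2 * Z)) by ring.
apply: ler_wpM2l; first by rewrite mulr_ge0 ?sqr_ge0.
apply: ler_pM => //; [by rewrite mulr_ge0 // ltW | exact: ltW |].
rewrite lerD2l; apply: (@le_trans _ _ (M * (Gam * s))).
  have -> : M * (Gam * s) = Gam * (M * s) by ring.
  by rewrite ler_pM2l.
have -> : 4 * M ^+ 2 * Z = M * (4 * M * Z) by ring.
rewrite ler_pM2l //; apply: le_trans ges _.
by rewrite ler_piMr // !mulr_ge0 // ltW.
Qed.

(** [k_B T / (eta D_i)] and [(sigma_i + sigma_j)^2] supply the three lengths
    that make [n_j] dimensionless. *)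
Lemma omega_hs_le i j :
  `|kT P / diffus P i * omega_hs P i j| <= M ^+ 5 * q.
Proof.
have := hs_friction_factor_le _ _ X3_tilde_itv.
rewrite /omega_hs; set f := _ / (1 + 2 * _) => f1.
have -> : kT P / diffus P i *
    (- ((diam P i + diam P j) ^+ 2 / (12 * visc P)) * conc P j * f) =
  (kT P / (visc P * diffus P i)) *
   ((diam P i + diam P j) ^+ 2 * (conc P j * (- (1 / 12) * f))).
  by field; rewrite !gt_eqF.
have kd0 : 0 <= kT P / (visc P * diffus P i).
  by rewrite divr_ge0 // ?mulr_ge0 // ltW.
apply: (@le_trans _ _
  (M ^+ 2 * s * ((2 * (M * s)) ^+ 2 * (conc P j * (1 / 12 * 1))))).
  apply: norm_mul_le; first by rewrite ger0_norm.
  apply: norm_mul_le.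
    rewrite ger0_norm ?sqr_ge0 //; apply: lerXn2r; rewrite ?nnegrE.
    - by rewrite addr_ge0 // ltW.
    - by rewrite !mulr_ge0 // ltW.
    - by have := diam_le i; have := diam_le j; lra.
  apply: norm_mul_le; first by rewrite gtr0_norm.
  by apply: norm_mul_le => //; rewrite normrN ger0_norm //; lra.
have -> : M ^+ 2 * s * ((2 * (M * s)) ^+ 2 * (conc P j * (1 / 12 * 1))) =
   M ^+ 4 / 3 * (conc P j * s ^+ 3) by field.
apply: (@le_trans _ _ (M ^+ 4 / 3 * (3 * M * xi))).
  by rewrite ler_wpM2l // divr_ge0 // exprn_ge0 // ltW.
have -> : M ^+ 4 / 3 * (3 * M * xi) = M ^+ 5 * xi by field.
by rewrite ler_wpM2l // exprn_ge0 // ltW.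
Qed.

(** By the screening equation, [2 * Gam^2] is [2 * pi * L] times the sum of
    [n_k z_k^2 / (1 + Gam sigma_k)^2], and the exponentials are at most 1. *)
Lemma relax_denominator_ge (kq : R) : 0 <= kq ->
  kq ^+ 2 <= kq ^+ 2 + 2 * Gam * kq + 2 * Gam ^+ 2 - 2 * pi * L *
    \sum_k conc P k *
      (zr k ^+ 2 * expR (- kq * diam P k) / (1 + Gam * diam P k) ^+ 2).
Proof.
move=> kq0; case: scr => _ G2.
set T := \sum_k _.
have TG : pi * L * T <= Gam ^+ 2.
  rewrite G2 ler_pM2l; last by rewrite mulr_gt0 // pi_gt0.
  apply: ler_sum => k _.
  rewrite mulrA ler_wpM2r ?invr_ge0 ?sqr_ge0 // mulrA ler_piMr ?charge_ge0 //.
  by rewrite -expR0 ler_expR mulNr oppr_le0 mulr_ge0 // ltW.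
have Gk : 0 <= 2 * Gam * kq by rewrite !mulr_ge0 // ltW.
lra.
Qed.

(** With [e^2 / (E k_B T) = 4 * pi * L], the relaxation term is, up to bounded
    factors, [z_i * z_j] times [L], times [(1 - exp (- 2 kappa_q a)) / a] for
    [a = sigma_i + sigma_j], times [kappa_q^2 / Den]. The quotient by [a]
    is at most [2 * kappa_q] and the last quotient at most 1; what remains is
    [L * kappa_q <= M * (kappa_q * s)]. *)
Lemma relax_le i j : `|relax z P Gam i j| <= 75 * M ^+ 2 * Z ^+ 2 * q.
Proof.
have kq0 : 0 <= kappa_q z P := sqrtr_ge0 _.
have kql := kappa_q_le.
have := relax_denominator_ge _ kq0.
rewrite /relax; move: (kappa_q z P) kq0 kql => kq kq0 kql.
set Den := (X in kq ^+ 2 <= X) => hD.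
have D0 : 0 <= Den := le_trans (sqr_ge0 _) hD.
set a := diam P i + diam P j.
have a0 : 0 < a by rewrite addr_gt0.
set di := 1 + Gam * diam P i; set dj := 1 + Gam * diam P j.
have di1 : 1 <= di := den_ge1 i.
have dj1 : 1 <= dj := den_ge1 j.
set E := 1 - _.
have /andP[E0 Ea] : 0 <= E <= 2 * kq * a.
  rewrite /E !mulNr; apply: one_minus_expRN_le.
  by rewrite !mulr_ge0 // ltW.
have d0 : 0 < di * dj by rewrite mulr_gt0 // (lt_le_trans ltr01).
have -> : kq ^+ 2 * echarge P ^+ 2 * zr i * zr j /
  (3 * diel P * kT P * a * di * dj) * (E / Den) =
  zr i * zr j * ((4 * pi / 3 * L) * (E / (a * (di * dj)) * (kq ^+ 2 / Den))).
  rewrite /bjerrum; move: (pi_gt0 R) Den^-1; move: pi => p p_gt0 iD; field.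
  by rewrite !gt_eqF // (lt_le_trans ltr01).
have hE : E / (a * (di * dj)) <= 2 * kq.
  rewrite ler_pdivrMr; last exact: mulr_gt0.
  apply: le_trans Ea _.
  apply: ler_wpM2l; first by rewrite mulr_ge0.
  by rewrite ler_peMr ?(ltW a0) // mulr_ege1.
have hE0 : 0 <= E / (a * (di * dj)).
  by rewrite divr_ge0 // ltW // mulr_gt0.
(* If [Den = 0], its inverse is 0 and the bound holds as well. *)
have hk : kq ^+ 2 / Den <= 1.
  have [->|Dn0] := eqVneq Den 0; first by rewrite invr0 mulr0.
  by rewrite ler_pdivrMr ?mul1r // lt0r Dn0.
have hk0 : 0 <= kq ^+ 2 / Den by rewrite divr_ge0 ?sqr_ge0.
have cpi : `|4 * pi / 3 * L| <= 16 / 3 * L.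
  apply: norm_mul_le; last by rewrite gtr0_norm.
  by rewrite ger0_norm; have := pi2; have := pi4; lra.
apply: (@le_trans _ _ (Z * (16 / 3 * L * (2 * kq * 1)))).
  apply: norm_mul_le => //; apply: norm_mul_le => //.
  by apply: norm_mul_le; rewrite ger0_norm.
have -> : Z * (16 / 3 * L * (2 * kq * 1)) = 32 / 3 * Z * (L * kq) by ring.
have -> : 75 * M ^+ 2 * Z ^+ 2 * q = 75 * Z * (M * (M * Z * q)) by ring.
have h : L * kq <= M * (7 * M * Z * q).
  apply: (@le_trans _ _ (M * (kq * s))); last by rewrite ler_pM2l.
  have -> : M * (kq * s) = M * s * kq by ring.
  by rewrite ler_wpM2r.
have h2 := ler_wpM2l Z_ge0 h.
have X0 : 0 <= Z * (M * (M * Z * q)) by rewrite !mulr_ge0 // ltW.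
rewrite -!mulrA in h2 X0 *; lra.
Qed.

(** [w] collects the constants of the two friction terms; [r] is that of the
    relaxation term. *)
Lemma Kcoef_le (i j : 'I_N)
    (w := 4 * M ^+ 3 * Z ^+ 2 * (1 + 4 * M ^+ 2 * Z) + M ^+ 5)
    (r := 75 * M ^+ 2 * Z ^+ 2) :
  `|Kcoef z P Gam i j - (i == j)%:R| <= (w + r + w * r) * q.
Proof.
apply: perturbed_product_le; last by rewrite q_ge0.
- by case: eqP; rewrite ?normr1 ?normr0.
- rewrite /omega mulrDr mulrDl; apply: le_trans (ler_normD _ _) _.
  by apply: lerD; [exact: omega_c_le | exact: omega_hs_le].
- exact: relax_le.
Qed.

End Estimates.

Theorem lemma1 (R : realType) (N : nat) (hN : (2 <= N)%N)
    (z : 'I_N -> int) (hz : valencies z) (M : R) :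
  exists C xi0 : R, 0 < C /\ 0 < xi0 /\
    forall (P : msa R N) (Gam : R),
      positive_data P -> bounded_data M P -> is_screening z P Gam ->
      xi_c P <= xi0 ->
      (forall i j : 'I_N,
         `|Kcoef z P Gam i j - (i == j)%:R| <= C * Num.sqrt (xi_c P)) /\
      (forall j : 'I_N,
         `|ln (activity z P Gam j)| <= C * Num.sqrt (xi_c P)).
Proof.
have [M1|M1] := leP 1 M; last first.
  (* No data satisfy the bounds when [M < 1]. *)
  exists 1, 1; do 2!split => //; move=> P Gam pos bnd.
  by have := bound_ge1 _ _ _ _ hN pos bnd; rewrite leNgt M1.
case: hz => z_neq0 _ _ _.
pose Z : R := \sum_k (z k)%:~R ^+ 2.
have Z0 : 0 <= Z by apply: sumr_ge0 => k _; rewrite sqr_ge0.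
have M0 : 0 < M := lt_le_trans ltr01 M1.
pose w := 4 * M ^+ 3 * Z ^+ 2 * (1 + 4 * M ^+ 2 * Z) + M ^+ 5.
pose r := 75 * M ^+ 2 * Z ^+ 2.
pose g := 64 * N%:R * M ^+ 4 + 4 * M ^+ 2 * Z ^+ 2.
have M0' := ltW M0.
have w0 : 0 < w.
  by rewrite ltr_wpDl ?exprn_gt0 // !(mulr_ge0, addr_ge0, exprn_ge0).
have r0 : 0 <= r by rewrite !(mulr_ge0, exprn_ge0).
have g0 : 0 <= g by rewrite !(mulr_ge0, addr_ge0, exprn_ge0).
have NM : 0 < N%:R * M ^+ 4 by rewrite mulr_gt0 ?exprn_gt0 // ltr0n ltnW.
have K0 : 0 < w + r + w * r
  by apply: ltr_wpDr; [exact: mulr_ge0 (ltW w0) r0 | exact: ltr_wpDr].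
exists (w + r + w * r + g), (1 / 2 / (N%:R * M ^+ 4)).
split; first by rewrite ltr_wpDr.
split; first by rewrite !divr_gt0.
move=> P Gam pos bnd scr; rewrite ler_pdivlMr // mulrC => xi_small.
split=> [i j|j].
  apply: (@le_trans _ _ ((w + r + w * r) * Num.sqrt (xi_c P))).
    exact: Kcoef_le.
  by rewrite ler_wpM2r ?sqrtr_ge0 // lerDl.
apply: (@le_trans _ _ (g * Num.sqrt (xi_c P))).
  exact: ln_activity_le.
by rewrite ler_wpM2r ?sqrtr_ge0 // lerDr ltW.
Qed.
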